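(* Let $d\ge n$ with $n\mid d$, let $f_1,\dots,f_n:\mathbb R^d\to\mathbb R$ be differentiable and $f=\frac1n\sum_{i=1}^nf_i$. Assume that $f$ is $L$-smooth with $L>0$ ($\|\nabla f(x)-\nabla f(y)\|\le L\|x-y\|$ for all $x,y$), that $f(x)\ge f^*$ for all $x$ for some $f^*\in\mathbb R$, and that the Functional $(L_A,L_B)$ Inequality holds for $f_1,\dots,f_n$. Run MARINA-P with $w_i^0=x^0$ for all $i\in[n]$, Perm$K$ compressors as $\mathcal C_i^t$ ($K=d/n$), probability $p=K/d=1/n$, and step size $\gamma=\big(L+L_A\sqrt{\omega_P(1/p-1)}\big)^{-1}$ with $\omega_P=n-1$. Then for every $\varepsilon>0$ the average server-to-worker communication complexity of MARINA-P for finding an $\varepsilon$-stationary point is $$\mathcal O\left(\frac{d\,\delta^0L}{n\,\varepsilon}+\frac{d\,\delta^0L_A}{\varepsilon}\right),\qquad \delta^0=f(x^0)-f^*.$$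
   Context: $\|\cdot\|$ is the Euclidean norm. Functional $(L_A,L_B)$ Inequality ($L_A,L_B\ge0$): for all $x,u_1,\dots,u_n\in\mathbb R^d$, $\|\frac1n\sum_{i=1}^n(\nabla f_i(x+u_i)-\nabla f_i(x))\|^2\le L_A^2(\frac1n\sum_{i=1}^n\|u_i\|^2)+L_B^2\|\frac1n\sum_{i=1}^nu_i\|^2$. Perm$K$ compressors ($d=qn$, $q=K=d/n$): draw one uniformly random permutation $\pi$ of $\{1,\dots,d\}$ and set $\mathcal C_i(x)=n\sum_{j=q(i-1)+1}^{qi}x_{\pi_j}e_{\pi_j}$ for $i=1,\dots,n$ (the same $\pi$ for all $i$). At each iteration $t$ a fresh independent permutation is used for $\mathcal C_1^t,\dots,\mathcal C_n^t$. MARINA-P: for $t=0,1,\dots$: $g^t=\frac1n\sum_{i=1}^n\nabla f_i(w_i^t)$; $x^{t+1}=x^t-\gamma g^t$; draw $c^t\sim\mathrm{Bernoulli}(p)$ (one coin for all workers); for all $i\in[n]$, $w_i^{t+1}=x^{t+1}$ if $c^t=1$ (the server sends worker $i$ the $d$ coordinates of $x^{t+1}$) and $w_i^{t+1}=w_i^t+\mathcal C_i^t(x^{t+1}-x^t)$ if $c^t=0$ (the server sends worker $i$ the $K=d/n$ selected coordinates of $\mathcal C_i^t(x^{t+1}-x^t)$). The coins are independent of each other and of the compressors. An $\varepsilon$-stationary point is a (possibly random) point $\bar x$ with $\mathbb E\|\nabla f(\bar x)\|^2\le\varepsilon$. The server-to-worker communication complexity is the expected number of coordinates the server sends to a worker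 in order to find an $\varepsilon$-stationary point; that it is $\mathcal O(N)$ means: there are a universal constant $c>0$ and an integer $T\ge0$ such that $\bar x$ drawn uniformly at random from $\{x^0,\dots,x^T\}$ (independently of everything else) is $\varepsilon$-stationary and the expected total number of coordinates sent by the server to each worker during iterations $t=0,\dots,T-1$ is at most $cN$. *)

(* Defs.v *)
From HB Require Import structures.
From mathcomp Require Import all_boot all_order all_algebra all_fingroup.
From mathcomp Require Import all_classical all_reals all_analysis.

Set Implicit Arguments.
Unset Strict Implicit.
Unset Printing Implicit Defensive.

Import Order.TTheory GRing.Theory Num.Theory.
Import numFieldNormedType.Exports.

Local Open Scope classical_set_scope.
Local Open Scope ring_scope.

(* The norm `|x| that the library puts on 'rV[R]_d is the sup norm, hence a
   separate Euclidean norm.  Differentiability does not depend on this choice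
   of norm on R^d. *)
Definition enorm (R : realType) (d : nat) (x : 'rV[R]_d) : R :=
  Num.sqrt (\sum_(j < d) x 0 j ^+ 2).

Definition grad (R : realType) (d : nat) (f : 'rV[R]_d -> R) (x : 'rV[R]_d) :
    'rV[R]_d :=
  \row_(j < d) 'D_(delta_mx 0 j) f x.

Definition average (R : realType) (V : lmodType R) (n : nat) (v : 'I_n -> V) : V :=
  n%:R^-1 *: \sum_(i < n) v i.

Definition favg (R : realType) (d n : nat) (f_ : 'I_n -> 'rV[R]_d -> R)
    (x : 'rV[R]_d) : R :=
  n%:R^-1 * \sum_(i < n) f_ i x.

Definition smooth (R : realType) (d : nat) (L : R) (f : 'rV[R]_d -> R) : Prop :=
  forall x y, enorm (grad f x - grad f y) <= L * enorm (x - y).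

Definition functional_inequality (R : realType) (d n : nat) (LA LB : R)
    (f_ : 'I_n -> 'rV[R]_d -> R) : Prop :=
  forall (x : 'rV[R]_d) (u : 'I_n -> 'rV[R]_d),
    enorm (average (fun i => grad (f_ i) (x + u i) - grad (f_ i) x)) ^+ 2
    <= LA ^+ 2 * (n%:R^-1 * \sum_(i < n) enorm (u i) ^+ 2)
       + LB ^+ 2 * enorm (average u) ^+ 2.

(* Workers are numbered from 0: worker i owns the positions
   q * i, ..., q * (i + 1) - 1, where q = d / n. *)
Definition permk_block (d n : nat) (i : 'I_n) : {set 'I_d} :=
  [set j : 'I_d | (d %/ n * i <= j < d %/ n * i.+1)%N].

Definition permk_coords (d n : nat) (s : 'S_d) (i : 'I_n) : {set 'I_d} :=
  [set s j | j in permk_block d i].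

Definition permk (R : realType) (d n : nat) (s : 'S_d) (i : 'I_n)
    (x : 'rV[R]_d) : 'rV[R]_d :=
  n%:R *: \sum_(j in permk_block d i) x 0 (s j) *: delta_mx 0 (s j).

Section MarinaP.
Variables (R : realType) (d n : nat).
Variables (f_ : 'I_n -> 'rV[R]_d -> R) (gamma : R) (x0 : 'rV[R]_d).

(* One sample path, driven by the coins c and by the compressors
   comp t i = C_i^t; the state at time t is (x^t, (w_i^t)_i). *)
Fixpoint marina_state (c : nat -> bool)
    (comp : nat -> 'I_n -> 'rV[R]_d -> 'rV[R]_d) (t : nat) :
    'rV[R]_d * ('I_n -> 'rV[R]_d) :=
  if t is t'.+1 then
    let: (x, w) := marina_state c comp t' in
    let g := average (fun i => grad (f_ i) (w i)) in
    let x' := x - gamma *: g in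
    (x', fun i => if c t' then x' else w i + comp t' i (x' - x))
  else (x0, fun=> x0).

Definition marina_permk_iterate (c : nat -> bool) (s : nat -> 'S_d) (t : nat) :
    'rV[R]_d :=
  (marina_state c (fun t => permk (s t)) t).1.

End MarinaP.

(* Number of coordinates sent to worker i during iterations 0, ..., T - 1. *)
Definition coords_sent (d n : nat) (c : nat -> bool) (s : nat -> 'S_d)
    (i : 'I_n) (T : nat) : nat :=
  (\sum_(t < T) if c t then d else #|permk_coords (s t) i|)%N.

HB.instance Definition _ (T : finType) := isPointed.Build (perm_type T) 1%g.
HB.instance Definition _ (T : finType) :=
  @isMeasurable.Build default_measure_display (perm_type T) discrete_measurable
    discrete_measurable0 discrete_measurableC discrete_measurableU.
HB.instance Definition _ (m : nat) := isPointed.Build 'I_m.+1 ord0.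
HB.instance Definition _ (m : nat) :=
  @isMeasurable.Build default_measure_display 'I_m.+1 discrete_measurable
    discrete_measurable0 discrete_measurableC discrete_measurableU.

Section Randomness.
Context (disp : measure_display) (Omega : measurableType disp) (R : realType).
Variable P : probability Omega R.

Definition mutually_independent (I : choiceType) (F : I -> set_system Omega) :
    Prop :=
  forall (r : seq I) (A : I -> set Omega),
    uniq r -> (forall i, i \in r -> F i (A i)) ->
    P (\bigcap_(i in [set` r]) A i) = (\prod_(i <- r) P (A i))%E.

Definition sigma_rv disp' (V : measurableType disp') (X : {RV P >-> V}) :
    set_system Omega :=
  preimage_set_system setT X measurable.

Definition uniform_rv (V : finType) (X : Omega -> V) : Prop :=
  forall v : V, P (X @^-1` [set v]) = (#|V|%:R^-1)%:E.

(* J is the index used to draw the output x^J among x^0, ..., x^T. *)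
Definition marina_sigma (d T : nat) (coin : nat -> {RV P >-> bool})
    (perm : nat -> {RV P >-> {perm 'I_d}}) (J : {RV P >-> 'I_T.+1})
    (k : nat + nat + unit) : set_system Omega :=
  match k with
  | inl (inl t) => sigma_rv (coin t)
  | inl (inr t) => sigma_rv (perm t)
  | inr _ => sigma_rv J
  end.

Definition marina_randomness (d T : nat) (p : R)
    (coin : nat -> {RV P >-> bool}) (perm : nat -> {RV P >-> {perm 'I_d}})
    (J : {RV P >-> 'I_T.+1}) : Prop :=
  [/\ forall t, distribution P (coin t) = bernoulli_prob p :> (set bool -> \bar R),
      forall t, uniform_rv (perm t),
      uniform_rv J
    & mutually_independent (marina_sigma coin perm J)].

Definition stationary (d : nat) (f : 'rV[R]_d -> R) (eps : R)
    (X : Omega -> 'rV[R]_d) : Prop :=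
  ('E_P[fun omega => (enorm (grad f (X omega)) ^+ 2)%R] <= eps%:E)%E.

End Randomness.

(* Main.v *)
Require Import Defs.
From HB Require Import structures.
From mathcomp Require Import all_boot all_order all_algebra all_fingroup.
From mathcomp Require Import all_classical all_reals all_analysis.
From mathcomp Require Import measurable_realfun ring lra.

Set Implicit Arguments.
Unset Strict Implicit.
Unset Printing Implicit Defensive.

Import Order.TTheory GRing.Theory Num.Theory.
Import numFieldNormedType.Exports.

Local Open Scope classical_set_scope.
Local Open Scope ring_scope.

(* Since the PermK compressors of the n workers have disjoint supports covering
   all coordinates, (1/n) sum_i C_i(h) = h on every sample path, so the mean of
   the w_i^t equals x^t exactly and the L_B term of the functional inequality
   vanishes.  What remains is the drift V^t = (1/n) sum_i |w_i^t - x^t|^2, and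
   averaging over one coin and one permutation gives
     E V^{t+1} = (1 - 1/n) (V^t + (n - 1) |x^{t+1} - x^t|^2).
   Hence f - f* + (gamma L_A^2 n / 2) V decreases in mean by at least
   (gamma / 2) |grad f(x^t)|^2 at each step, so the mean of |grad f|^2 over
   x^0, ..., x^T is at most 2 delta0 / (gamma (T + 1)).  The choice
   T = floor (2 delta0 / (gamma eps)) makes this at most eps without any
   additive rounding cost, and each iteration costs at most 2 d / n coordinates
   in mean.  All expectations reduce to finite sums over the histories of the
   pairs (coin, permutation). *)

(** * Euclidean geometry and smoothness *)


Section Euclidean.
Context {R : realType} {d : nat}.
Implicit Types (x y h : 'rV[R]_d) (f : 'rV[R]_d -> R).

Definition dotp x y : R := \sum_(j < d) x 0 j * y 0 j.

Lemma dotpC x y : dotp x y = dotp y x.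
Proof. by apply: eq_bigr => j _; rewrite mulrC. Qed.

Lemma dotpDl x y h : dotp (x + y) h = dotp x h + dotp y h.
Proof. by rewrite -big_split; apply: eq_bigr => j _; rewrite mxE mulrDl. Qed.

Lemma dotpZl (k : R) x y : dotp (k *: x) y = k * dotp x y.
Proof. by rewrite mulr_sumr; apply: eq_bigr => j _; rewrite mxE mulrA. Qed.

Lemma dotpBl x y h : dotp (x - y) h = dotp x h - dotp y h.
Proof. by rewrite -scaleN1r dotpDl dotpZl mulN1r. Qed.

Lemma dotpDr x y h : dotp h (x + y) = dotp h x + dotp h y.
Proof. by rewrite !(dotpC h) dotpDl. Qed.

Lemma dotpZr (k : R) x y : dotp x (k *: y) = k * dotp x y.
Proof. by rewrite !(dotpC x) dotpZl. Qed.

Lemma dotpBr x y h : dotp h (x - y) = dotp h x - dotp h y.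
Proof. by rewrite !(dotpC h) dotpBl. Qed.

Lemma dotp_sumr (I : finType) x (y : I -> 'rV[R]_d) :
  dotp x (\sum_i y i) = \sum_i dotp x (y i).
Proof.
rewrite /dotp exchange_big; apply: eq_bigr => j _.
by rewrite summxE mulr_sumr.
Qed.

Lemma dotp0r x : dotp x 0 = 0.
Proof. by rewrite -(scale0r 0) dotpZr mul0r. Qed.

Lemma dotpp_ge0 x : 0 <= dotp x x.
Proof. by apply: sumr_ge0 => j _; rewrite -expr2 sqr_ge0. Qed.

Lemma enorm_sqr x : enorm x ^+ 2 = dotp x x.
Proof.
rewrite /enorm sqr_sqrtr; first by apply: eq_bigr => j _; rewrite expr2.
by apply: sumr_ge0 => j _; exact: sqr_ge0.
Qed.

Lemma enorm_ge0 x : 0 <= enorm x.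
Proof. exact: sqrtr_ge0. Qed.

Lemma derive_dotp_grad f x h :
  differentiable f x -> 'D_h f x = dotp (grad f x) h.
Proof.
move=> df; rewrite deriveE// {1}(row_sum_delta h) linear_sum.
by apply: eq_bigr => j _; rewrite linearZ/= mxE deriveE// mulrC.
Qed.

Lemma is_derive_segment f x h (t : R) :
  differentiable f (x + t *: h) ->
  is_derive t 1 (fun u : R => f (x + u *: h)) (dotp (grad f (x + t *: h)) h).
Proof.
move=> df; rewrite -derive_dotp_grad//; have dh := @diff_derivable _ _ _ _ _ h df.
set g := fun u : R => _.
have E : (fun e : R => e^-1 *: ((g \o shift t) (e *: (1 : R)) - g t)) =
    (fun e : R => e^-1 *: ((f \o shift (x + t *: h)) (e *: h) - f (x + t *: h))).
  apply/funext => e /=; congr (_ *: (f _ - _)).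
  by rewrite [e *: (1 : R)]mulr1 scalerDl addrCA.
apply: DeriveDef; first by rewrite /derivable E.
by rewrite /derive E.
Qed.

(** The mean value theorem is applied to [phi], the gap between the two sides along the segment from
    x to x + h; its derivative is nonpositive on (0, 1). *)
Lemma smooth_upper_bound f (L : R) x h :
  0 < L -> (forall y, differentiable f y) -> smooth L f ->
  f (x + h) <= f x + dotp (grad f x) h + L / 2 * dotp h h.
Proof.
move=> L0 df sf.
pose phi (t : R) : R :=
  f (x + t *: h) - t * dotp (grad f x) h - L / 2 * dotp h h * t ^+ 2.
pose dphi (t : R) : R := dotp (grad f (x + t *: h)) h - dotp (grad f x) h
   - L * dotp h h * t.
have phiE (t : R) : is_derive t 1 phi (dphi t).
  have ? := is_derive_segment (df (x + t *: h)).
  rewrite /phi; apply: is_derive_eq.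
  rewrite /dphi /GRing.scale/=; by field.
have phic : {within `[(0:R), 1], continuous phi}.
  apply: continuous_subspaceT; move=> u; apply: differentiable_continuous.
  by apply/derivable1_diffP; have [] := phiE u.
have [t t01 E] := MVT ltr01 (fun t _ => phiE t) phic.
have t0 : 0 < t by move: t01; rewrite in_itv /= => /andP[].
suff : dphi t <= 0.
  move: E; rewrite subr0 mulr1 => <-; rewrite /phi scale1r scale0r addr0 => *.
  lra.
have := sf (x + t *: h) x; rewrite addrAC subrr add0r /dphi -dotpBl.
move: (grad f _ - grad f x) => u le_u; rewrite subr_le0.
have Lt0 : 0 < L * t by rewrite mulr_gt0.
have : dotp u u <= (L * t) ^+ 2 * dotp h h.
  rewrite -!enorm_sqr -exprMn; apply: lerXn2r; rewrite ?nnegrE ?enorm_ge0//.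
    by rewrite mulr_ge0 ?enorm_ge0// ltW.
  apply: le_trans le_u _; rewrite -mulrA ler_pM2l//.
  rewrite -ler_sqr ?nnegrE ?mulr_ge0 ?enorm_ge0 ?(ltW t0)//.
  by rewrite exprMn !enorm_sqr dotpZl dotpZr mulrA -expr2.
(* In place of Cauchy-Schwarz: expanding this square gives 2Lt<u,h> <= |u|^2 + (Lt)^2|h|^2 <=
   2(Lt)^2|h|^2, and Lt > 0 cancels. *)
have := dotpp_ge0 (u - (L * t) *: h).
rewrite !(dotpBl, dotpBr, dotpZl, dotpZr) (dotpC h u).
set a := dotp u u; set b := dotp u h; set c := dotp h h => u1 u2.
rewrite -(ler_pM2l Lt0); nra.
Qed.

End Euclidean.

(** * The PermK compressors *)

Section PermK.
Context {R : realType} {d n : nat}.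
Hypotheses (n_gt0 : (0 < n)%N) (n_dvd_d : (n %| d)%N).
Implicit Types (s : 'S_d) (i : 'I_n) (k : 'I_d) (x : 'rV[R]_d).

Lemma dim_gt0 k : (0 < d)%N.
Proof. exact: leq_ltn_trans (ltn_ord k). Qed.

Lemma block_size_gt0 k : (0 < d %/ n)%N.
Proof. by rewrite divn_gt0// dvdn_leq// (dim_gt0 k). Qed.

Lemma mem_permk_block i k : (k \in permk_block d i) = (k %/ (d %/ n) == i)%N.
Proof.
have q0 := block_size_gt0 k.
by rewrite inE eqn_leq leq_divRL// -[(k %/ _ <= i)%N]ltnS ltn_divLR// andbC
  !(mulnC (d %/ n)%N).
Qed.

Lemma card_permk_block i : #|permk_block d i| = (d %/ n)%N.
Proof.
set q := (d %/ n)%N.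
have le_d : (q * i.+1 <= d)%N by rewrite -[leqRHS](divnK n_dvd_d) leq_mul2l ltn_ord orbT.
rewrite -sum1_card big_mkcond/= (eq_bigr (fun k : 'I_d =>
  if (q * i <= k < q * i.+1)%N then 1%N else 0%N)); last by move=> k _; rewrite inE.
rewrite -(big_mkord xpredT (fun j => if (q * i <= j < q * i.+1)%N then 1%N else 0%N)).
rewrite -big_mkcond -(big_nat_widen 0 _ d (fun j => q * i <= j)%N)//.
rewrite -(@big_nat_widenl _ _ _ (q * i) 0 _ xpredT)// sum_nat_const_nat muln1.
by rewrite mulnSr addKn.
Qed.

Lemma card_permk_coords s i : #|permk_coords s i| = (d %/ n)%N.
Proof. by rewrite card_imset ?card_permk_block//; exact: perm_inj. Qed.

(** The blocks partition the positions: k lies only in block k / (d/n), which is less than n because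
    n divides d. *)
Lemma sum_mem_permk_block k :
  \sum_(i < n) (k \in permk_block d i)%:R = 1 :> R.
Proof.
have kq : (k %/ (d %/ n) < n)%N.
  by rewrite ltn_divLR ?(block_size_gt0 k)// mulnC divnK.
rewrite (bigD1 (Ordinal kq))//= big1 ?addr0 ?mem_permk_block ?eqxx// => i.
by rewrite mem_permk_block -val_eqE/= eq_sym => /negPf->.
Qed.

(** Passing to s^-1 confines the permutation to a 0/1 indicator, whose sums over workers and over
    permutations can be counted. *)
Lemma permkE s i x k :
  permk s i x 0 k = n%:R * x 0 k * ((s^-1)%g k \in permk_block d i)%:R.
Proof.
rewrite mxE summxE big_mkcond/= (bigD1 ((s^-1)%g k))//= big1 => [|j jk].
  rewrite addr0 permKV -mulrA; congr (_ * _).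
  by case: ifP => _; rewrite ?mulr0// !mxE !eqxx.
case: ifP => // _; rewrite !mxE eqxx/= [k == _]eq_sym.
by rewrite -(inj_eq (@perm_inj _ (s^-1)%g)) permK (negPf jk) mulr0.
Qed.

Lemma average_permk s x : average (fun i => permk s i x) = x.
Proof.
apply/rowP => k; rewrite mxE summxE.
under eq_bigr do rewrite permkE.
by rewrite -mulr_sumr sum_mem_permk_block mulr1 mulKf// pnatr_eq0 -lt0n.
Qed.

(** For a 0/1 indicator b, (nb - 1)^2 = 1 + (n^2 - 2n) b, and the indicators of one coordinate sum
    to 1 over the workers. No averaging over s is involved. *)
Lemma permk_total_variance s x :
  \sum_(i < n) dotp (permk s i x - x) (permk s i x - x) =
  n%:R * (n%:R - 1) * dotp x x.
Proof.
rewrite exchange_big/= mulr_sumr; apply: eq_bigr => k _.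
pose b i : R := ((s^-1)%g k \in permk_block d i)%:R.
rewrite (eq_bigr (fun i => x 0 k * x 0 k *
    (1 + (n%:R * n%:R - 2 * n%:R) * b i))) => [|i _].
  rewrite -mulr_sumr big_split/= -mulr_sumr sum_mem_permk_block.
  by rewrite sumr_const card_ord; ring.
by rewrite mxE permkE mxE -/(b i) /b; case: (_ \in _) => /=; ring.
Qed.

(** Double counting: the number [N j] of permutations sending j into block i is the same for all j,
    by composing with a transposition, and these numbers add up to d/n per permutation. *)
Lemma sum_perm_mem_permk_block i k :
  \sum_(s : 'S_d) ((s^-1)%g k \in permk_block d i)%:R = #|'S_d|%:R / n%:R :> R.
Proof.
have d0 := dim_gt0 k.
pose N j : R := \sum_(s : 'S_d) (s j \in permk_block d i)%:R.
have N_cst j : N j = N k.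
  rewrite /N [RHS](reindex_inj (mulgI (tperm j k)))/=.
  by apply: eq_bigr => s _; rewrite permM tpermR.
have dN : d%:R * N k = #|'S_d|%:R * (d %/ n)%:R.
  transitivity (\sum_(j < d) N j).
    by under eq_bigr do rewrite N_cst; rewrite sumr_const card_ord mulr_natl.
  rewrite exchange_big/= mulr_natl -sumr_const; apply: eq_bigr => s _.
  rewrite -(card_permk_block i) -sum1_card natr_sum [RHS]big_mkcond/=.
  rewrite [RHS](reindex_inj (@perm_inj _ s))/=.
  by apply: eq_bigr => j _; case: (_ \in _).
transitivity (N k).
  by rewrite /N [RHS](reindex_inj invg_inj).
have nR : n%:R != 0 :> R by rewrite pnatr_eq0 -lt0n.
have qR : (d %/ n)%:R != 0 :> R by rewrite pnatr_eq0 -lt0n (block_size_gt0 k).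
apply: (mulfI (mulf_neq0 qR nR)).
by rewrite -[in LHS]natrM divnK// dN; field.
Qed.

(** Unbiasedness of each compressor, in the form that kills cross terms. *)
Lemma sum_perm_permk i x : \sum_(s : 'S_d) (permk s i x - x) = 0.
Proof.
apply/rowP => k; rewrite summxE [RHS]mxE.
under eq_bigr do rewrite mxE permkE [X in _ + X]mxE.
rewrite big_split/= -mulr_sumr sum_perm_mem_permk_block sumr_const.
rewrite -mulr_natl; field.
by rewrite pnatr_eq0 -lt0n.
Qed.

End PermK.

(** * One iteration *)

Section OneStep.
Context {R : realType} {d n : nat}.
Hypotheses (n_gt0 : (0 < n)%N) (n_dvd_d : (n %| d)%N).
Variables (f_ : 'I_n -> 'rV[R]_d -> R) (gamma : R).
Implicit Types (x h : 'rV[R]_d) (w y : 'I_n -> 'rV[R]_d) (a : bool * 'S_d).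

(** The joint law of a Bernoulli(1/n) coin and an independent uniform permutation. *)
Definition sample_weight a : R :=
  (if a.1 then n%:R^-1 else 1 - n%:R^-1) / #|'S_d|%:R.

Definition sample_mean (G : bool * 'S_d -> R) : R :=
  \sum_a sample_weight a * G a.

Lemma card_perm_neq0 : #|'S_d|%:R != 0 :> R.
Proof. by rewrite pnatr_eq0 -lt0n; apply/card_gt0P; exists 1%g. Qed.

Lemma sample_meanE (G : bool * 'S_d -> R) :
  sample_mean G = n%:R^-1 * (\sum_s G (true, s)) / #|'S_d|%:R
    + (1 - n%:R^-1) * (\sum_s G (false, s)) / #|'S_d|%:R.
Proof.
rewrite /sample_mean (eq_bigr (fun a => sample_weight (a.1, a.2) * G (a.1, a.2))).
  rewrite -(pair_bigA _ (fun b s => sample_weight (b, s) * G (b, s)))/=.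
  by rewrite big_bool /sample_weight/= -!mulr_sumr ![_ / _ * _]mulrAC.
by case.
Qed.

Lemma sample_mean_cst (k : R) : sample_mean (fun=> k) = k.
Proof.
rewrite sample_meanE !sumr_const -mulr_natl; field.
by rewrite card_perm_neq0 pnatr_eq0 -lt0n.
Qed.

Lemma sample_meanD (F G : bool * 'S_d -> R) :
  sample_mean (fun a => F a + G a) = sample_mean F + sample_mean G.
Proof.
by rewrite /sample_mean -big_split; apply: eq_bigr => a _; rewrite mulrDr.
Qed.

Lemma sample_meanZ (k : R) (G : bool * 'S_d -> R) :
  sample_mean (fun a => k * G a) = k * sample_mean G.
Proof.
by rewrite /sample_mean mulr_sumr; apply: eq_bigr => a _; rewrite mulrCA.
Qed.

(** Expanding the square, the cross terms vanish by unbiasedness and the compression error is the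
    same for every permutation. *)
Lemma sum_perm_dotp_permk y h :
  \sum_(s : 'S_d) \sum_(i < n)
    dotp (y i + (permk s i h - h)) (y i + (permk s i h - h)) =
  #|'S_d|%:R * (\sum_(i < n) dotp (y i) (y i) + n%:R * (n%:R - 1) * dotp h h).
Proof.
transitivity (\sum_(s : 'S_d) (\sum_(i < n) dotp (y i) (y i)
    + n%:R * (n%:R - 1) * dotp h h)
    + \sum_(i < n) 2 * dotp (y i) (\sum_(s : 'S_d) (permk s i h - h))).
  under [X in _ + X]eq_bigr do rewrite dotp_sumr mulr_sumr.
  rewrite [X in _ + X]exchange_big -big_split/=; apply: eq_bigr => s _.
  rewrite -(permk_total_variance n_gt0 n_dvd_d s h) -!big_split/=.
  apply: eq_bigr => i _; move: (permk s i h - h) => z.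
  by rewrite dotpDl !dotpDr (dotpC z (y i)); ring.
rewrite [X in X + _]sumr_const -[X in X + _]mulr_natl.
rewrite [X in _ + X]big1 ?addr0// => i _.
by rewrite sum_perm_permk// dotp0r mulr0.
Qed.

(** One unfolding of [marina_state] with its randomness as an explicit argument, ready to be
    averaged out. *)
Definition marina_step (xw : 'rV[R]_d * ('I_n -> 'rV[R]_d)) a :
    'rV[R]_d * ('I_n -> 'rV[R]_d) :=
  let x' := xw.1 - gamma *: average (fun i => grad (f_ i) (xw.2 i)) in
  (x', fun i => if a.1 then x' else xw.2 i + permk a.2 i (x' - xw.1)).

Definition drift (xw : 'rV[R]_d * ('I_n -> 'rV[R]_d)) : R :=
  n%:R^-1 * \sum_(i < n) dotp (xw.2 i - xw.1) (xw.2 i - xw.1).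

Lemma sample_mean_drift xw :
  let g := average (fun i => grad (f_ i) (xw.2 i)) in
  sample_mean (fun a => drift (marina_step xw a)) =
  (1 - n%:R^-1) * (drift xw + (n%:R - 1) * gamma ^+ 2 * dotp g g).
Proof.
case: xw => x w /=; set g := average _.
(* A refresh makes every copy equal to the new iterate, so the coin [true] contributes no drift. *)
rewrite sample_meanE /drift/= [X in n%:R^-1 * X]big1 => [|s _]; last first.
  by rewrite big1 ?mulr0// => i _; rewrite subrr dotp0r.
rewrite mulr0 mul0r add0r -mulr_sumr.
(* Without a refresh, with h = - gamma g the increment of x, the new deviation is the old one plus
   the compression error C_i(h) - h. *)
rewrite (eq_bigr (fun s : 'S_d => \sum_(i < n)
    dotp ((w i - x) + (permk s i (- gamma *: g) - - gamma *: g))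
         ((w i - x) + (permk s i (- gamma *: g) - - gamma *: g)))).
  rewrite sum_perm_dotp_permk dotpZl dotpZr; field.
  by rewrite card_perm_neq0 andbT pnatr_eq0 -lt0n.
move=> s _; apply: eq_bigr => i _; rewrite -/g.
suff -> : w i + permk s i (x - gamma *: g - x) - (x - gamma *: g) =
  w i - x + (permk s i (- gamma *: g) - - gamma *: g) by [].
rewrite [x - _ - x]addrAC subrr add0r -scaleNr opprD scaleNr !opprK.
by rewrite [LHS]addrACA.
Qed.

Lemma average_cst (V : lmodType R) (v : V) : average (fun _ : 'I_n => v) = v.
Proof.
rewrite /average sumr_const card_ord -[v *+ n]scaler_nat scalerA mulVf ?scale1r//.
by rewrite pnatr_eq0 -lt0n.
Qed.

Lemma averageD (V : lmodType R) (u v : 'I_n -> V) :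
  average (fun i => u i + v i) = average u + average v.
Proof. by rewrite /average big_split scalerDr. Qed.

Lemma averageB (V : lmodType R) (u v : 'I_n -> V) :
  average (fun i => u i - v i) = average u - average v.
Proof. by rewrite /average sumrB scalerBr. Qed.

Lemma average_marina_step xw a :
  average xw.2 = xw.1 -> average (marina_step xw a).2 = (marina_step xw a).1.
Proof.
case: xw => x w /= wx; case: a => -[] s; rewrite /marina_step/= ?average_cst//.
by rewrite averageD average_permk// wx addrC subrK.
Qed.

Lemma grad_favg x : (forall i, differentiable (f_ i) x) ->
  grad (favg f_) x = average (fun i => grad (f_ i) x).
Proof.
move=> df; apply/rowP => j; rewrite !mxE summxE.
rewrite (_ : favg f_ = n%:R^-1 \*: (\sum_(i < n) f_ i)); last first.
  by apply/funext => z; rewrite /favg/= fct_sumE.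
rewrite deriveZ; last by apply: derivable_sum => i; exact: diff_derivable.
rewrite derive_sum; last by move=> i; exact: diff_derivable.
by congr (_ * _); apply: eq_bigr => i _; rewrite mxE.
Qed.

Lemma differentiable_favg x : (forall i, differentiable (f_ i) x) ->
  differentiable (favg f_) x.
Proof.
move=> df; rewrite (_ : favg f_ = n%:R^-1 \*: (\sum_(i < n) f_ i)); last first.
  by apply/funext => z; rewrite /favg/= fct_sumE.
by apply: differentiableZ; exact: differentiable_sum.
Qed.

(** * Descent of the Lyapunov function *)

Variables (L LA LB fstar : R).
Hypotheses (df : forall i x, differentiable (f_ i) x).
Hypotheses (L_gt0 : 0 < L) (smooth_f : smooth L (favg f_)).
Hypotheses (ABineq : functional_inequality LA LB f_).
Hypotheses (gamma_gt0 : 0 < gamma)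
  (gamma_small : L * gamma + (LA * (n%:R - 1) * gamma) ^+ 2 <= 1).

Definition lyapunov (xw : 'rV[R]_d * ('I_n -> 'rV[R]_d)) : R :=
  favg f_ xw.1 - fstar + gamma * LA ^+ 2 * n%:R / 2 * drift xw.

(** Smoothness along - gamma g, then the polarization -2<v,g> = |g - v|^2 - |v|^2 - |g|^2 with v the
    true gradient; this second step is an equality. *)
Lemma biased_gradient_descent x (g : 'rV[R]_d) :
  favg f_ (x - gamma *: g) <= favg f_ x
    - gamma / 2 * dotp (grad (favg f_) x) (grad (favg f_) x)
    - (gamma - L * gamma ^+ 2) / 2 * dotp g g
    + gamma / 2 * dotp (g - grad (favg f_) x) (g - grad (favg f_) x).
Proof.
have df' z : differentiable (favg f_) z by exact: differentiable_favg.
rewrite (_ : x - gamma *: g = x + - gamma *: g); last by rewrite scaleNr.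
apply: le_trans (smooth_upper_bound x (- gamma *: g) L_gt0 df' smooth_f) _.
move: (grad _ x) => v.
rewrite !(dotpBl, dotpBr, dotpZl, dotpZr) (dotpC v g).
by rewrite le_eqVlt; apply/orP; left; apply/eqP; field.
Qed.

(** The functional inequality is taken at u_i = w_i - x, whose mean is zero by assumption. *)
Lemma gradient_error xw : average xw.2 = xw.1 ->
  let e := average (fun i => grad (f_ i) (xw.2 i)) - grad (favg f_) xw.1 in
  dotp e e <= LA ^+ 2 * drift xw.
Proof.
case: xw => x w /= wx; rewrite grad_favg// -averageB.
have := ABineq x (fun i => w i - x).
rewrite !enorm_sqr averageB wx average_cst subrr dotp0r mulr0 addr0.
rewrite (_ : (fun i => grad (f_ i) (x + (w i - x)) - grad (f_ i) x) =
    (fun i => grad (f_ i) (w i) - grad (f_ i) x)); last first.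
  by apply/funext => i; rewrite [x + _]addrC subrK.
by rewrite /drift /=; under eq_bigr do rewrite enorm_sqr.
Qed.

(* The weight of the drift is chosen so that refreshing with probability 1/n
   absorbs the gradient error. *)
Lemma lyapunov_decrease xw : average xw.2 = xw.1 ->
  sample_mean (fun a => lyapunov (marina_step xw a)) <=
  lyapunov xw - gamma / 2 * dotp (grad (favg f_) xw.1) (grad (favg f_) xw.1).
Proof.
move=> wx; have := gradient_error wx; rewrite /lyapunov/=.
rewrite sample_meanD sample_mean_cst sample_meanZ sample_mean_drift.
set g := average _; have := biased_gradient_descent xw.1 g.
move: (grad _ xw.1) (g - _) => v e.
set gg := dotp g g; set ee := dotp e e; set D := drift xw.
have gg0 : 0 <= gg by exact: dotpp_ge0.
move=> fle ele.
have nR : n%:R != 0 :> R by rewrite pnatr_eq0 -lt0n.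
(* Since n(1 - 1/n) = n - 1, the drift term loses exactly the bound on the gradient error, and the
   noise becomes the square occurring in [gamma_small]. *)
have eq1 : gamma * LA ^+ 2 * n%:R / 2 *
    ((1 - n%:R^-1) * (D + (n%:R - 1) * gamma ^+ 2 * gg)) =
  gamma * LA ^+ 2 * n%:R / 2 * D - gamma / 2 * (LA ^+ 2 * D)
  + gamma / 2 * (LA * (n%:R - 1) * gamma) ^+ 2 * gg by field.
rewrite eq1.
have le1 : gamma / 2 * ee <= gamma / 2 * (LA ^+ 2 * D).
  by rewrite ler_pM2l ?divr_gt0.
(* The -|g|^2 term of the descent pays for both smoothness and compression noise. *)
have le2 : gamma / 2 * (L * gamma + (LA * (n%:R - 1) * gamma) ^+ 2) * gg
    <= gamma / 2 * gg.
  by rewrite ler_wpM2r// ler_piMr ?divr_ge0// ltW.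
lra.
Qed.

End OneStep.

(** * Finite histories *)

Section History.
Context {R : realType} {d n : nat}.
Hypotheses (n_gt0 : (0 < n)%N) (n_dvd_d : (n %| d)%N).
Implicit Types (a : bool * 'S_d) (h : seq (bool * 'S_d)).

(** Histories grow at the end, so the latest pair is averaged first, given the past. *)
Fixpoint histories (m : nat) : seq (seq (bool * 'S_d)) :=
  if m is k.+1 then
    [seq rcons h a | h <- histories k, a <- index_enum (bool * 'S_d)%type]
  else [:: [::]].

Lemma mem_histories m h : (h \in histories m) = (size h == m).
Proof.
elim: m h => [|m IH] h; first by rewrite inE size_eq0.
apply/allpairsP/eqP => [[[h' a] /= [h'm _ ->]]|].
  by move: h'm; rewrite IH size_rcons => /eqP->.
case/lastP: h => [//|h a]; rewrite size_rcons => -[hm].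
by exists (h, a); rewrite /= IH hm eqxx mem_index_enum.
Qed.

Lemma uniq_histories m : uniq (histories m).
Proof.
elim: m => [//|m IH]; apply: allpairs_uniq => //; first exact: index_enum_uniq.
by move=> [h a] [h' a'] _ _ /= /rcons_inj[-> ->].
Qed.

Definition history_mean (m : nat) (G : seq (bool * 'S_d) -> R) : R :=
  \sum_(h <- histories m) (\prod_(a <- h) sample_weight (n := n) a) * G h.

Lemma history_mean0 (G : seq (bool * 'S_d) -> R) : history_mean 0 G = G [::].
Proof. by rewrite /history_mean big_seq1 big_nil mul1r. Qed.

(** The tower property: condition on the first m pairs. *)
Lemma history_meanS m (G : seq (bool * 'S_d) -> R) :
  history_mean m.+1 G =
  history_mean m (fun h => sample_mean (n := n) (fun a => G (rcons h a))).
Proof.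
rewrite /history_mean/= big_allpairs_dep; apply: eq_bigr => h _.
rewrite /sample_mean mulr_sumr; apply: eq_bigr => a _.
by rewrite -cats1 big_cat big_seq1/= mulrA.
Qed.

Lemma sample_weight_ge0 a : 0 <= sample_weight (n := n) a :> R.
Proof.
apply: divr_ge0 => //; case: a.1; first by rewrite invr_ge0.
by rewrite subr_ge0 invf_le1 ?ltr0n// ler1n.
Qed.

Lemma le_history_mean m (F G : seq (bool * 'S_d) -> R) :
  (forall h, size h = m -> F h <= G h) -> history_mean m F <= history_mean m G.
Proof.
move=> FG; rewrite /history_mean big_seq [leRHS]big_seq; apply: ler_sum => h.
rewrite mem_histories => /eqP/FG; apply: ler_wpM2l.
by apply: prodr_ge0 => a _; exact: sample_weight_ge0.
Qed.

Lemma history_meanZ m (k : R) (G : seq (bool * 'S_d) -> R) :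
  history_mean m (fun h => k * G h) = k * history_mean m G.
Proof.
by rewrite /history_mean mulr_sumr; apply: eq_bigr => h _; rewrite mulrCA.
Qed.

Lemma history_mean_sum_nth m (C : bool * 'S_d -> R) a0 :
  history_mean m (fun h => \sum_(t < m) C (nth a0 h t)) =
  m%:R * sample_mean (n := n) C.
Proof.
(* The offset b absorbs the mean of the last pair in the induction. *)
suff H (b : R) : history_mean m (fun h => b + \sum_(t < m) C (nth a0 h t)) =
    b + m%:R * sample_mean (n := n) C.
  rewrite -[RHS]add0r -H; congr history_mean.
  by apply/funext => h; rewrite add0r.
elim: m b => [|m IH] b; first by rewrite history_mean0 big_ord0 mul0r.
rewrite history_meanS mulrSr mulrDl mul1r [_ + sample_mean _]addrC addrA -IH.
rewrite /history_mean big_seq [RHS]big_seq; apply: eq_bigr => h.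
rewrite mem_histories => /eqP hm; congr (_ * _).
rewrite (_ : (fun a => _) =
    (fun a => b + \sum_(t < m) C (nth a0 h t) + C a)); last first.
  apply/funext => a; rewrite big_ord_recr/= addrA nth_rcons hm ltnn eqxx.
  congr (_ + _ + _); apply: eq_bigr => t _.
  by rewrite nth_rcons hm ltn_ord.
by rewrite sample_meanD sample_mean_cst// addrAC.
Qed.

Variables (f_ : 'I_n -> 'rV[R]_d -> R) (gamma : R) (x0 : 'rV[R]_d).

(** Causality: it lets a finite history replace the infinite driving sequences. *)
Lemma eq_marina_state (c c' : nat -> bool)
    (comp comp' : nat -> 'I_n -> 'rV[R]_d -> 'rV[R]_d) (t : nat) :
  (forall k, (k < t)%N -> c k = c' k) ->
  (forall k, (k < t)%N -> comp k = comp' k) ->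
  marina_state f_ gamma x0 c comp t = marina_state f_ gamma x0 c' comp' t.
Proof.
elim: t => [//|t IH] cc' pp' /=; rewrite IH => [|k kt|k kt]; last first.
- by apply: pp'; rewrite ltnW.
- by apply: cc'; rewrite ltnW.
by rewrite cc'// pp'.
Qed.

(** Default for [nth]; states are read at times up to the length of the history, hence from genuine
    entries. *)
Let a0 : bool * 'S_d := (false, 1%g).

Definition history_state h (t : nat) : 'rV[R]_d * ('I_n -> 'rV[R]_d) :=
  marina_state f_ gamma x0 (fun k => (nth a0 h k).1)
    (fun k => permk (nth a0 h k).2) t.

Lemma history_state_rcons h a t : (t <= size h)%N ->
  history_state (rcons h a) t = history_state h t.
Proof.
move=> th; apply: eq_marina_state => k kt;
  by rewrite nth_rcons (leq_trans kt th).
Qed.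

Lemma history_state_step h a m : size h = m ->
  history_state (rcons h a) m.+1 = marina_step f_ gamma (history_state h m) a.
Proof.
move=> hm; rewrite -(@history_state_rcons h a m) ?hm// {1}/history_state/=.
rewrite -/(history_state _ _); case: (history_state _ _) => x w.
by rewrite nth_rcons hm ltnn eqxx.
Qed.

Lemma average_history_state h :
  average (history_state h (size h)).2 = (history_state h (size h)).1.
Proof.
elim/last_ind: h => [|h a IH]; first exact: average_cst.
rewrite size_rcons (history_state_step a (erefl (size h))).
exact: average_marina_step.
Qed.

Variables (L LA LB fstar : R).
Hypotheses (df : forall i x, differentiable (f_ i) x).
Hypotheses (L_gt0 : 0 < L) (smooth_f : smooth L (favg f_)).
Hypotheses (fstar_le : forall x, fstar <= favg f_ x).
Hypotheses (ABineq : functional_inequality LA LB f_).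
Hypotheses (gamma_gt0 : 0 < gamma)
  (gamma_small : L * gamma + (LA * (n%:R - 1) * gamma) ^+ 2 <= 1).

Definition sq_grad h (t : nat) : R := enorm (grad (favg f_) (history_state h t).1) ^+ 2.

(** Adding the accumulated squared gradients makes the potential nonincreasing in mean, so induction
    does the telescoping; the initial drift is zero. *)
Lemma history_mean_lyapunov m :
  history_mean m (fun h => lyapunov f_ gamma LA fstar (history_state h m)
                           + gamma / 2 * \sum_(t < m) sq_grad h t)
  <= favg f_ x0 - fstar.
Proof.
elim: m => [|m IH].
  rewrite history_mean0 big_ord0 mulr0 addr0 /lyapunov /drift/= big1 ?mulr0 ?addr0//.
  by move=> i _; rewrite subrr dotp0r.
apply: le_trans IH; rewrite history_meanS; apply: le_history_mean => h hm.
(* The iterate at time m is already determined by the first m pairs. *)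
have E a : \sum_(t < m.+1) sq_grad (rcons h a) t = \sum_(t < m.+1) sq_grad h t.
  apply: eq_bigr => t _.
  by rewrite /sq_grad history_state_rcons// hm -ltnS.
rewrite (_ : (fun a => _) = (fun a =>
    lyapunov f_ gamma LA fstar (marina_step f_ gamma (history_state h m) a)
    + gamma / 2 * \sum_(t < m.+1) sq_grad h t)); last first.
  apply/funext => a.
  exact: (f_equal2 (fun u v => lyapunov f_ gamma LA fstar u + gamma / 2 * v)
    (history_state_step a hm) (E a)).
rewrite sample_meanD sample_mean_cst// big_ord_recr/= mulrDr.
have := average_history_state h; rewrite hm => /(lyapunov_decrease n_gt0 n_dvd_d
  fstar df L_gt0 smooth_f ABineq gamma_gt0 gamma_small).
rewrite /sq_grad enorm_sqr; lra.
Qed.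

Lemma history_mean_sq_grad m :
  history_mean m (fun h => \sum_(t < m) sq_grad h t)
  <= 2 * (favg f_ x0 - fstar) / gamma.
Proof.
rewrite ler_pdivlMr// mulrC -ler_pdivrMl// mulrA [2^-1 * _]mulrC -history_meanZ.
apply: le_trans (history_mean_lyapunov m); apply: le_history_mean => h _.
(* The final Lyapunov value is nonnegative and is dropped. *)
rewrite lerDr /lyapunov addr_ge0 ?subr_ge0//; apply: mulr_ge0.
  by rewrite divr_ge0// mulr_ge0// mulr_ge0 ?sqr_ge0// ltW.
apply: mulr_ge0; first by rewrite invr_ge0.
by apply: sumr_ge0 => i _; exact: dotpp_ge0.
Qed.

End History.

(** * Expectations over the sample space *)

(** The integrand is a finite combination of indicators of the fibres of Z, so V needs no
    sigma-algebra, only measurable fibres. *)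
Lemma expectation_finite_range (R : realType) (disp : measure_display)
    (Omega : measurableType disp) (P : probability Omega R) (V : eqType)
    (r : seq V) (Z : Omega -> V) (F : V -> R) :
  uniq r -> (forall omega, Z omega \in r) ->
  (forall v, v \in r -> measurable (Z @^-1` [set v])) -> (forall v, 0 <= F v) ->
  ('E_P[fun omega => F (Z omega)] =
   \sum_(v <- r) (F v)%:E * P (Z @^-1` [set v]))%E.
Proof.
move=> r_uniq Zr mZ F0; rewrite unlock.
(* Empty outside r, so that [B v] is measurable for every v, as the exchange of sum and integral
   requires. *)
pose B v := if v \in r then Z @^-1` [set v] else set0.
have mB v : measurable (B v) by rewrite /B; case: ifP => [/mZ|].
transitivity (\int[P]_omega \sum_(v <- r) ((F v)%:E * (\1_(B v) omega)%:E))%E.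
  apply: eq_integral => omega _.
  rewrite (bigD1_seq (Z omega))//= big_seq_cond big1 => [|v /andP[vr vZ]].
    by rewrite adde0 indicE /B Zr mem_set// mule1.
  rewrite indicE /B vr memNset ?mule0//= => Zv.
  by move: vZ; rewrite Zv eqxx.
rewrite ge0_integral_sum//=; last 2 first.
- by move=> v; apply: measurable_funeM; exact/measurable_EFinP.
- by move=> v omega _; rewrite mule_ge0// lee_fin.
rewrite big_seq [RHS]big_seq; apply: eq_bigr => v vr.
rewrite ge0_integralZl ?lee_fin//; last exact/measurable_EFinP.
by rewrite integral_indic// setIT /B vr.
Qed.

Section ObservedHistory.
Context {R : realType} {disp : measure_display} {Omega : measurableType disp}.
Context {P : probability Omega R} {d n T : nat}.
Variables (coin : nat -> {RV P >-> bool}) (sigma : nat -> {RV P >-> {perm 'I_d}})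
  (J : {RV P >-> 'I_T.+1}).
Hypotheses (n_gt0 : (0 < n)%N)
  (rand : marina_randomness (n%:R^-1 : R) coin sigma J).

Definition observed_history (m : nat) (omega : Omega) : seq (bool * 'S_d) :=
  mkseq (fun t => (coin t omega, sigma t omega)) m.

Let a0 : bool * 'S_d := (false, 1%g).

(** Indexed like [marina_sigma], so that fixing the history and J is an intersection to which mutual
    independence applies. *)
Let event (h : seq (bool * 'S_d)) (j : 'I_T.+1) (k : nat + nat + unit) :
    set Omega :=
  match k with
  | inl (inl t) => coin t @^-1` [set (nth a0 h t).1]
  | inl (inr t) => sigma t @^-1` [set (nth a0 h t).2]
  | inr _ => J @^-1` [set j]
  end.

Let indices (m : nat) : seq (nat + nat + unit) :=
  [seq inl (inl t) | t <- iota 0 m] ++ [seq inl (inr t) | t <- iota 0 m]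
    ++ [:: inr tt].

Let observed (m : nat) (omega : Omega) : seq (bool * 'S_d) * 'I_T.+1 :=
  (observed_history m omega, J omega).

Let observed_preimage m h j : size h = m ->
  observed m @^-1` [set (h, j)] = \bigcap_(k in [set` indices m]) event h j k.
Proof.
move=> hm; apply/seteqP; split=> omega /=.
  case=> hE jE k; rewrite /indices/= !mem_cat.
  case/or3P => [/mapP[t]|/mapP[t]|]; last by rewrite inE => /eqP->.
  - rewrite mem_iota add0n => /= tm ->.
    by rewrite /= -hE /observed_history nth_mkseq.
  - rewrite mem_iota add0n => /= tm ->.
    by rewrite /= -hE /observed_history nth_mkseq.
move=> all_k; congr (_, _); last first.
  by apply: (all_k (inr tt)); rewrite /indices/= !mem_cat inE eqxx !orbT.
apply: (@eq_from_nth _ a0); rewrite size_mkseq// => t tm; rewrite nth_mkseq//.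
have tI : t \in iota 0 m by rewrite mem_iota.
have /= -> := all_k (inl (inl t)) _; last first.
  by rewrite /indices/= !mem_cat map_f.
have /= -> := all_k (inl (inr t)) _; last first.
  by rewrite /indices/= !mem_cat map_f// orbT.
by case: (nth _ _ _).
Qed.

Let event_sigma h j k : marina_sigma coin sigma J k (event h j k).
Proof.
by case: k => [[t|t]|u] /=;
  [exists [set (nth a0 h t).1]|exists [set (nth a0 h t).2]|exists [set j]];
  rewrite ?setTI.
Qed.

Let measurable_event h j k : measurable (event h j k).
Proof. by case: k => [[t|t]|u]; apply: measurable_funPTI. Qed.

Let uniq_indices m : uniq (indices m).
Proof.
rewrite /indices !cat_uniq !map_inj_uniq ?iota_uniq//=; last 2 first.
- by move=> t t' [].
- by move=> t t' [].
rewrite orbF andbT; apply/andP; split.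
  rewrite has_cat/= orbF negb_or; apply/andP; split.
    by apply/hasPn => k /mapP[t _ ->]; apply/mapP => -[].
  by apply/mapP => -[].
by apply/mapP => -[].
Qed.

(** Independence gives a product over coins, permutations and J; the coin and permutation factors of
    equal time regroup into [sample_weight]. *)
Let measure_observed m h j : size h = m ->
  P (observed m @^-1` [set (h, j)]) =
  (\prod_(a <- h) sample_weight (n := n) a * T.+1%:R^-1)%:E.
Proof.
move=> hm; have [coinP sigmaP JP indep] := rand.
rewrite observed_preimage// indep => [||k _]; last 2 first.
- exact: uniq_indices.
- exact: event_sigma.
rewrite /indices !big_cat/= !big_map big_seq1/= JP card_ord muleA -big_split/=.
rewrite EFinM; congr (_ * _)%E.
rewrite (big_nth a0) hm -/(index_iota 0 m) (big_morph EFin EFinM (erefl _)).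
rewrite /index_iota subn0 big_seq [RHS]big_seq; apply: eq_bigr => t _.
rewrite /sample_weight EFinM sigmaP; congr (_ * _)%E.
have p01 : 0 <= (n%:R^-1 : R) <= 1.
  by rewrite invr_ge0 ler0n invf_le1 ?ltr0n// ler1n.
have /(congr1 (fun mu : set bool -> \bar R => mu [set (nth a0 h t).1])) := coinP t.
rewrite /distribution/pushforward bernoulli_probE// => ->.
rewrite !diracE; case: (nth _ _ _).1.
  by rewrite mem_set// memNset// mule1 mule0 adde0.
by rewrite memNset// mem_set// mule1 mule0 add0e.
Qed.

(** The bridge from the sample space to finite sums; J, uniform and independent of the history,
    becomes a plain average over j. *)
Lemma expectation_observed_history m (F : seq (bool * 'S_d) -> 'I_T.+1 -> R) :
  (forall h j, 0 <= F h j) ->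
  ('E_P[fun omega => F (observed_history m omega) (J omega)] =
  (history_mean (n := n) m (fun h => T.+1%:R^-1 * \sum_j F h j))%:E)%E.
Proof.
move=> F0.
pose r := [seq (h, j) | h <- @histories d m, j <- index_enum 'I_T.+1].
have rP (h : seq (bool * 'S_d)) (j : 'I_T.+1) : ((h, j) \in r) = (size h == m).
  rewrite -mem_histories; apply/allpairsP/idP => [[[h' j'] [+ _ [-> _]]]|hm] //.
  by exists (h, j); rewrite mem_index_enum.
have -> := @expectation_finite_range _ _ _ P _ r (observed m) (fun v => F v.1 v.2).
- rewrite big_allpairs /history_mean -sumEFin big_seq [RHS]big_seq.
  apply: eq_bigr => h; rewrite mem_histories => /eqP hm.
  rewrite !mulr_sumr -sumEFin; apply: eq_bigr => j _.
  by rewrite measure_observed// -EFinM mulrC mulrA.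
- apply: allpairs_uniq; rewrite ?uniq_histories ?index_enum_uniq//.
  by move=> [? ?] [? ?].
- by move=> omega; rewrite rP size_mkseq.
- move=> [h j]; rewrite rP => /eqP hm; rewrite observed_preimage//.
  by apply: fin_bigcap_measurable => // k _; exact: measurable_event.
- by move=> [h j]; exact: F0.
Qed.

End ObservedHistory.

Lemma marina_permk_iterate_observed (R : realType) (d n : nat)
    (disp : measure_display) (Omega : measurableType disp)
    (P : probability Omega R) (f_ : 'I_n -> 'rV[R]_d -> R) (gamma : R)
    (x0 : 'rV[R]_d) (coin : nat -> {RV P >-> bool})
    (sigma : nat -> {RV P >-> {perm 'I_d}}) m t omega : (t <= m)%N ->
  marina_permk_iterate f_ gamma x0 (coin ^~ omega) (sigma ^~ omega) t =
  (history_state f_ gamma x0 (observed_history coin sigma m omega) t).1.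
Proof.
move=> tm; congr fst; apply: eq_marina_state => k kt;
  by rewrite nth_mkseq// (leq_trans kt).
Qed.

(** * Communication cost, step size and the final bound *)

Definition step_coords (R : realType) (d n : nat) (a : bool * 'S_d) : R :=
  (if a.1 then d else (d %/ n)%N)%:R.

Lemma coords_sent_observed (R : realType) (d n : nat)
    (disp : measure_display) (Omega : measurableType disp)
    (P : probability Omega R) (coin : nat -> {RV P >-> bool})
    (sigma : nat -> {RV P >-> {perm 'I_d}}) (i : 'I_n) T omega a0 :
  (n %| d)%N ->
  (coords_sent (coin ^~ omega) (sigma ^~ omega) i T)%:R =
  \sum_(t < T) step_coords R n (nth a0 (observed_history coin sigma T omega) t).
Proof.
move=> n_dvd_d; rewrite /coords_sent natr_sum; apply: eq_bigr => t _.
by rewrite nth_mkseq// /step_coords/= card_permk_coords.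
Qed.

(** A refresh costs d with probability 1/n, a compressed message d/n: each contributes at most d/n
    in mean. *)
Lemma sample_mean_step_coords (R : realType) (d n : nat) :
  (0 < n)%N -> (n %| d)%N ->
  sample_mean (n := n) (@step_coords R d n) <= 2 * (d%:R / n%:R).
Proof.
move=> n_gt0 n_dvd_d; rewrite sample_meanE /step_coords/= !sumr_const.
have nR : n%:R != 0 :> R by rewrite pnatr_eq0 -lt0n.
have -> : (d %/ n)%:R = d%:R / n%:R :> R.
  by apply: (mulIf nR); rewrite -natrM divnK// divfK.
have cst (c k : R) : c * (k *+ #|'S_d|) / #|'S_d|%:R = c * k.
  by rewrite -[k *+ _]mulr_natr mulrA mulfK// card_perm_neq0.
rewrite !cst.
have : 0 <= n%:R^-1 * (d%:R / n%:R) :> R.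
  by rewrite mulr_ge0 ?divr_ge0// invr_ge0.
lra.
Qed.

(** With A = L_A (n - 1) and a = A / (L + A) in [0, 1], the second quantity is 1 - a + a^2. *)
Lemma marina_stepsize (R : realType) (n : nat) (L LA : R) :
  (0 < n)%N -> 0 < L -> 0 <= LA ->
  let gamma := (L + LA * (n%:R - 1))^-1 in
  0 < gamma /\ L * gamma + (LA * (n%:R - 1) * gamma) ^+ 2 <= 1.
Proof.
move=> n_gt0 L_gt0 LA_ge0 /=; set A := LA * _.
have A0 : 0 <= A by rewrite mulr_ge0// subr_ge0 ler1n.
have s0 : 0 < L + A by rewrite ltr_pwDl.
split; first by rewrite invr_gt0.
have -> : L / (L + A) = 1 - A / (L + A) by field; rewrite gt_eqF.
have : 0 <= A / (L + A) by rewrite divr_ge0// ltW.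
have : A / (L + A) <= 1 by rewrite ler_pdivrMr// mul1r lerDr ltW.
nra.
Qed.

Theorem corollary4p7 (R : realType) :
  exists c : R, 0 < c /\
  forall (d n : nat) (f_ : 'I_n -> 'rV[R]_d -> R) (L LA LB fstar : R)
         (x0 : 'rV[R]_d) (eps : R),
    (0 < n)%N -> (n <= d)%N -> (n %| d)%N ->
    (forall i x, differentiable (f_ i) x) ->
    0 < L -> 0 <= LA -> 0 <= LB ->
    smooth L (favg f_) ->
    (forall x, fstar <= favg f_ x) ->
    functional_inequality LA LB f_ ->
    0 < eps ->
    let p : R := n%:R^-1 in
    let omegaP : R := n%:R - 1 in
    let gamma : R := (L + LA * Num.sqrt (omegaP * (p^-1 - 1)))^-1 in
    let delta0 : R := favg f_ x0 - fstar in
    exists T : nat,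
    forall (disp : measure_display) (Omega : measurableType disp)
           (P : probability Omega R)
           (coin : nat -> {RV P >-> bool})
           (perm : nat -> {RV P >-> {perm 'I_d}})
           (J : {RV P >-> 'I_T.+1}),
      marina_randomness p coin perm J ->
      let x (t : nat) (omega : Omega) : 'rV[R]_d :=
        marina_permk_iterate f_ gamma x0 (coin ^~ omega) (perm ^~ omega) t in
      stationary P (favg f_) eps (fun omega => x (J omega) omega) /\
      forall i : 'I_n,
        ('E_P[fun omega =>
                (coords_sent (coin ^~ omega) (perm ^~ omega) i T)%:R%R : R]
         <= (c * (d%:R * delta0 * L / (n%:R * eps)
                  + d%:R * delta0 * LA / eps))%R%:E)%E.
Proof.
(* A factor 2 comes from the horizon 2 delta0 / (gamma eps), another from the mean cost 2d/n per
   iteration. *)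
exists 4; split=> //.
move=> d n f_ L LA LB fstar x0 eps n_gt0 _ n_dvd_d df L_gt0 LA_ge0 LB_ge0 sf
  fstar_le ABineq eps_gt0 p omegaP gamma delta0.
(* For p = 1/n the radicand is (n - 1)^2. *)
have gammaE : gamma = (L + LA * (n%:R - 1))^-1.
  rewrite /gamma /omegaP /p invrK -expr2 sqrtr_sqr ger0_norm//.
  by rewrite subr_ge0 ler1n.
have [gamma_gt0 gamma_small] := marina_stepsize n_gt0 L_gt0 LA_ge0.
rewrite -gammaE in gamma_gt0 gamma_small.
have delta0_ge0 : 0 <= delta0 by rewrite subr_ge0.
pose tau := 2 * delta0 / gamma / eps.
have tau_ge0 : 0 <= tau by rewrite /tau !divr_ge0 ?(ltW gamma_gt0) ?(ltW eps_gt0) ?mulr_ge0.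
(* tau < T + 1 serves the accuracy, T <= tau the cost; if tau < 1, then T = 0 and nothing is
   sent. *)
have /andP[T_le lt_T1] := truncn_itv tau_ge0.
exists (Num.truncn tau); set T := Num.truncn tau in T_le lt_T1 *.
move=> disp Omega P coin sigma J rand x.
split=> [|i].
  rewrite /stationary.
  (* Length T + 1 rather than T, so that the bound on the sum of gradients covers x^0, ..., x^T. *)
  rewrite (_ : (fun omega => _) = (fun omega =>
      sq_grad f_ gamma x0 (observed_history coin sigma T.+1 omega) (J omega))).
    rewrite (expectation_observed_history n_gt0 rand T.+1
      (F := fun h (j : 'I_T.+1) => sq_grad f_ gamma x0 h j)); last first.
      by move=> h j; exact: sqr_ge0.
    rewrite lee_fin history_meanZ ler_pdivrMl//.
    apply: le_trans (history_mean_sq_grad n_gt0 n_dvd_d x0 df L_gt0 sf fstar_le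
      ABineq gamma_gt0 gamma_small T.+1) _.
    by rewrite -ler_pdivrMr// ltW// -natr1.
  apply/funext => omega; rewrite /x /sq_grad.
  by rewrite (@marina_permk_iterate_observed _ _ _ _ _ _ _ _ _ _ _ T.+1)// ltnW.
pose a0 : bool * 'S_d := (false, 1%g).
rewrite (_ : (fun omega => _) = (fun omega =>
    \sum_(t < T) step_coords R n
      (nth a0 (observed_history coin sigma T omega) t))); last first.
  by apply/funext => omega; rewrite (coords_sent_observed _ _ _ _ _ a0).
rewrite (expectation_observed_history n_gt0 rand T (F := fun h (_ : 'I_T.+1) =>
  \sum_(t < T) step_coords R n (nth a0 h t))); last first.
  by move=> h j; apply: sumr_ge0.
rewrite lee_fin.
(* The cost is constant in j, so the sum over the T + 1 indices cancels the factor 1/(T + 1). *)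
rewrite (_ : (fun h => _) = (fun h => \sum_(t < T) step_coords R n (nth a0 h t)));
  last first.
  apply/funext => h; rewrite sumr_const card_ord; set c := \sum_(t < T) _.
  by rewrite -[c *+ _]mulr_natl mulKf// pnatr_eq0.
rewrite history_mean_sum_nth//.
apply: (@le_trans _ _ (tau * (2 * (d%:R / n%:R)))).
  apply: ler_pM => //; last exact: sample_mean_step_coords.
  apply: sumr_ge0 => a _; rewrite mulr_ge0//.
  exact: sample_weight_ge0.
rewrite /tau gammaE invrK.
have nR : n%:R != 0 :> R by rewrite pnatr_eq0 -lt0n.
have epsR : eps != 0 by rewrite gt_eqF.
(* The -1 in n - 1 leaves a nonnegative surplus, which is discarded. *)
have -> : 2 * delta0 * (L + LA * (n%:R - 1)) / eps * (2 * (d%:R / n%:R)) =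
  4 * (d%:R * delta0 * L / (n%:R * eps) + d%:R * delta0 * LA / eps)
  - 4 * (delta0 * LA * d%:R / n%:R / eps) by field; rewrite nR epsR.
by rewrite gerBl mulr_ge0// divr_ge0 ?(ltW eps_gt0)// divr_ge0// mulr_ge0// mulr_ge0.
Qed.
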